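(* Let $\rho\in(0,1)$, $\gamma>0$ and let $\alpha\in(0,1/2)$ be such that $R_q:=q/(2\alpha)$ is an integer for every positive integer $q$. Let $\mathcal{P}_R$ denote the power of the level-$\alpha$ randomization test with $R$ unmirrored allocations (defined in the context). Then $\mathcal{P}_R$ increases monotonically along the attainable values of $R$: for every integer $q\ge 1$, $$\mathcal{P}_{R_{q+1}}>\mathcal{P}_{R_q}.$$
   Context: Power model. An experiment with $n$ subjects (half treated, half control) uses $R$ allocation vectors $w_1,\dots,w_R\in\{-1,+1\}^n$ together with their mirrors $-w_1,\dots,-w_R$. Assume that the observed covariate imbalance is zero, that the pairwise allocation correlations $r_{ij}=w_i^\top w_j/n$ satisfy $|r_{ij}|=\rho$ for all $i\ne j$, and that the standardized imbalances in the unobserved response component are jointly normal, standardized and equicorrelated with correlation $\rho$. With $\gamma=\sqrt n\,\beta$ the sample-size-scaled treatment effect, this amounts to the following. Let $Z_0,Z_1,\dots,Z_R$ be i.i.d. standard normal and define the (scaled) treatment effect estimates when the experiment is run with $w_1$ as $$V_{1,1}=\sqrt{\rho}\,Z_0+\sqrt{1-\rho}\,Z_1+\gamma,\qquad V_{1,j}=\sqrt{\rho}\,Z_0+\sqrt{1-\rho}\,Z_j+\rho\gamma\quad(j=2,\dots,R),$$ with mirror estimates $V_{1,j}^m=-V_{1,j}$ for $j=1,\dots,R$. The power of the level-$\alpha$ randomization test is $$\mathcal{P}_R=\mathbb{P}\Big(V_{1,1}>\mathrm{Quantile}\big[\{V_{1,1},V_{1,1}^m,\dots,V_{1,R},V_{1,R}^m\},\,1-\alpha\big]\Big),$$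 where $\mathrm{Quantile}[L,1-\alpha]$ of a finite list $L$ is the smallest entry $x$ of $L$ such that at least a fraction $1-\alpha$ of the entries of $L$ are $\le x$. A value of $R$ is called attainable if $2\alpha R$ is a positive integer. *)

(* Defs.v *)
From mathcomp Require Import all_boot all_order all_algebra.
From mathcomp Require Import all_classical all_reals all_analysis.

Set Implicit Arguments.
Unset Strict Implicit.
Unset Printing Implicit Defensive.

Import Order.TTheory GRing.Theory Num.Theory.

Local Open Scope classical_set_scope.
Local Open Scope ring_scope.

(* The default 0 is only reached when no entry qualifies; see quantileP. *)
Definition quantile (R : realType) (L : seq R) (t : R) : R :=
  head 0 (sort <=%R
    [seq x <- L | t * (size L)%:R <= (count (fun y => y <= x) L)%:R]).

Lemma quantileP (R : realType) (L : seq R) (t : R) : L != [::] -> t <= 1 ->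
  let good x := t * (size L)%:R <= (count (fun y => y <= x) L)%:R in
  [/\ quantile L t \in L, good (quantile L t) &
      forall x, x \in L -> good x -> quantile L t <= x].
Proof.
move=> L0 t1 good.
set s := [seq x <- L | good x].
have sortedL : sorted <=%R (sort <=%R L) by exact: sort_le_sorted.
have sN0 : s != [::].
  set m := last 0 (sort <=%R L).
  have mL : m \in L.
    rewrite -(mem_sort <=%R) /m.
    have : sort <=%R L != [::] by rewrite -size_eq0 size_sort size_eq0.
    by case: (sort <=%R L) => // a l _; exact: (mem_last a l).
  have Lm y : y \in L -> y <= m.
    rewrite -(mem_sort <=%R) /m => yL.
    rewrite -nth_last -[leLHS](nth_index 0 yL).
    have := yL; rewrite -index_mem => ilt.
    apply: (sorted_leq_nth le_trans lexx) => //.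
    - by rewrite inE prednK// (leq_ltn_trans _ ilt).
    - by rewrite -ltnS prednK// (leq_ltn_trans _ ilt).
  have : m \in s.
    rewrite mem_filter mL andbT /good.
    have -> : count (fun y => y <= m) L = size L.
      by apply/eqP; rewrite -all_count; apply/allP.
    by rewrite ler_piMl// ler0n.
  by case: (s).
have qE : quantile L t = head 0 (sort <=%R s) by [].
have qs : quantile L t \in s.
  rewrite qE -(mem_sort <=%R).
  have : sort <=%R s != [::] by rewrite -size_eq0 size_sort size_eq0.
  by case: (sort <=%R s) => // a l _; rewrite /= mem_head.
split.
- by move: qs; rewrite mem_filter => /andP[].
- by move: qs; rewrite mem_filter => /andP[].
- move=> x xL gx.
  have : x \in sort <=%R s by rewrite mem_sort mem_filter gx.
  have : sorted <=%R (sort <=%R s) by exact: sort_le_sorted.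
  rewrite qE; case: (sort <=%R s) => //= a l pl.
  rewrite inE => /predU1P[->//|xl].
  by move: pl; rewrite (path_sortedE le_trans) => /andP[/allP/(_ _ xl)].
Qed.

Section model.
Context d (T : measurableType d) (R : realType) (P : probability T R).

Definition mutually_independent (I : finType) (X : I -> {RV P >-> R}) :=
  forall (J : {set I}) (A : I -> set R), (forall i, measurable (A i)) ->
    P (\bigcap_(i in [set i | i \in J]) (X i @^-1` A i)) =
    (\prod_(i in J) P (X i @^-1` A i))%E.

Definition standard_normal (X : {RV P >-> R}) :=
  forall A : set R, measurable A -> distribution P X A = normal_prob 0 1 A.

(* Only Z 0, ..., Z n are constrained. *)
Definition iid_standard_normal (n : nat) (Z : nat -> {RV P >-> R}) :=
  mutually_independent (fun i : 'I_n.+1 => Z i) /\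
  (forall i : 'I_n.+1, standard_normal (Z i)).

(* The index j = 1 is the allocation the experiment is run with. *)
Definition estimate (rho gamma : R) (Z : nat -> {RV P >-> R}) (j : nat)
    (w : T) : R :=
  Num.sqrt rho * Z 0%N w + Num.sqrt (1 - rho) * Z j w +
  (if j == 1%N then gamma else rho * gamma).

Definition mirror_estimate (rho gamma : R) (Z : nat -> {RV P >-> R}) (j : nat)
    (w : T) : R :=
  - estimate rho gamma Z j w.

Definition reference_list (rho gamma : R) (n : nat) (Z : nat -> {RV P >-> R})
    (w : T) : seq R :=
  flatten [seq [:: estimate rho gamma Z j w; mirror_estimate rho gamma Z j w]
          | j <- iota 1 n].

(* Here n is the number of unmirrored allocations. If Z 0, ..., Z n are i.i.d.
   standard normal, this is determined by rho, gamma, alpha and n, independently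
   of the probability space that carries Z. *)
Definition power (rho gamma alpha : R) (n : nat) (Z : nat -> {RV P >-> R}) :
    \bar R :=
  P [set w | estimate rho gamma Z 1 w >
             quantile (reference_list rho gamma n Z w) (1 - alpha)].

End model.

(* Main.v *)
From HB Require Import structures.
Require Import Defs.
From mathcomp Require Import all_boot all_order all_algebra all_fingroup.
From mathcomp Require Import all_classical all_reals all_analysis.
From mathcomp Require Import measurable_realfun ring lra zify.

Set Implicit Arguments.
Unset Strict Implicit.
Unset Printing Implicit Defensive.

Import Order.TTheory GRing.Theory Num.Theory.

(* Put m = 1 / (2 alpha), so that R_q = q m.  The test rejects iff V_1 > 0 and
   |V_1| is among the q largest of |V_1|, ..., |V_(R_q)|.  The mean of
   (V_j)_j is gamma times the first column of its covariance matrix, so the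
   law of (V_j)_j has density exp (gamma V_1 - gamma^2 / 2) with respect to the
   law for gamma = 0.  Under the latter, a global change of sign and the
   permutations of the indices are symmetries.  Hence, for any N >= R_q,
     2 exp (gamma^2 / 2) P_(R_q)
       = E [exp (gamma |V_(s 1)|); |V_(s 1)| is among the q largest of
                                   |V_(s 1)|, ..., |V_(s R_q)|]
   where s is a uniformly random permutation of 1, ..., N.  Take N = R_(q+1)
   and fix the |V_j|, almost surely distinct.  Given them, the events for
   (R_q, q) and for (N, q+1) both have probability 1 / m, but the latter always
   selects one of the q+1 largest values, whereas the former selects the
   (q+2)-nd largest one with positive probability. *)

Local Open Scope ring_scope.

(** * Largest entries of a finite family *)

Section top_entries.
Context (R : realFieldType).

(* Only the first n entries are counted, while i ranges over all positions;
   entries tied with u i, u i itself included, count against it. *)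
Definition among_top (N n q : nat) (u : 'I_N -> R) (i : 'I_N) : bool :=
  (#|[set j : 'I_N | (j < n)%N && (u i <= u j)%R]| <= q)%N.

(** At a position where [u] is smallest on the set, every element of the set counts against it, and
    at most [q] entries may do so. *)
Lemma card_among_top_le N n q (u : 'I_N -> R) :
  (#|[set k : 'I_N | (k < n)%N && among_top n q u k]| <= q)%N.
Proof.
set S := [set k | _]; have [->|[i0 i0S]] := set_0Vmem S; first by rewrite cards0.
case: (@Order.TotalTheory.arg_minP _ _ _ i0 (mem S) u i0S) => k0 k0S k0min.
have : k0 \in S by [].
rewrite inE => /andP[_]; apply: leq_trans; apply: fintype.subset_leq_card.
apply/fintype.subsetP => k kS; rewrite inE k0min// andbT.
by move: kS; rewrite inE => /andP[].
Qed.

Lemma card_ord_lt N n : (n <= N)%N -> #|[set j : 'I_N | (j < n)%N]| = n.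
Proof.
move=> nN; rewrite -sum1_card (eq_bigl (fun j : 'I_N => (j < n)%N)).
  by rewrite -(big_ord_widen N (fun=> 1%N) nN) sum1_card card_ord.
by move=> j; rewrite inE.
Qed.

Definition nb_above N (u : 'I_N -> R) (i : 'I_N) : nat :=
  #|[set j : 'I_N | u i < u j]|.

Lemma nb_above_ltn N (u : 'I_N -> R) i : (nb_above u i < N)%N.
Proof.
rewrite -[ltnRHS]card_ord -cardsT; apply: proper_card.
apply/fintype.properP; split; first exact: finset.subsetT.
by exists i; rewrite !inE// ltxx.
Qed.

Lemma nb_above_lt N (u : 'I_N -> R) i j : u i < u j -> (nb_above u j < nb_above u i)%N.
Proof.
move=> ij; apply: proper_card; apply/fintype.properP; split.
  by apply/fintype.subsetP => k; rewrite !inE; exact: lt_trans.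
by exists j; rewrite !inE// ltxx.
Qed.

Lemma nb_above_le N (u : 'I_N -> R) i j :
  (nb_above u j <= nb_above u i)%N = (u i <= u j).
Proof.
have [ij|ji|ij] := ltgtP (u i) (u j); first by rewrite ltnW// nb_above_lt.
  by apply/negbTE; rewrite -ltnNge nb_above_lt.
rewrite -[RHS](leqnn (nb_above u i)); congr (_ <= _)%N.
by rewrite /nb_above ij.
Qed.

Definition rank N (u : 'I_N -> R) (i : 'I_N) : 'I_N :=
  Ordinal (nb_above_ltn u i).

Lemma rank_inj N (u : 'I_N -> R) : injective u -> injective (rank u).
Proof.
move=> u_inj i j /(congr1 val)/= uij; apply: u_inj; apply/eqP.
by rewrite eq_le -!nb_above_le uij leqnn.
Qed.

Lemma nb_above_surj N (u : 'I_N -> R) r : injective u -> (r < N)%N ->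
  exists i, nb_above u i = r.
Proof.
move=> u_inj rN; have [g _ gK] := injF_bij (rank_inj u_inj).
by exists (g (Ordinal rN)); have /(congr1 val) := gK (Ordinal rN).
Qed.

(** Without ties, the entries counted against [i] are [i] itself and those strictly above it; hence
    the change from [<=] to [<]. *)
Lemma among_topE N q (u : 'I_N -> R) i : injective u ->
  among_top N q u i = (nb_above u i < q)%N.
Proof.
move=> u_inj; rewrite /among_top.
rewrite (_ : [set _ | _] = i |: [set j | u i < u j]).
  by rewrite cardsU1 inE ltxx.
apply/finset.setP => j; rewrite !inE ltn_ord/= le_eqVlt (inj_eq u_inj).
by rewrite eq_sym.
Qed.

Lemma card_among_top N q (u : 'I_N -> R) : injective u -> (q <= N)%N ->
  #|[set k : 'I_N | (k < N)%N && among_top N q u k]| = q.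
Proof.
move=> u_inj qN.
rewrite (_ : [set _ | _] = rank u @^-1: [set x : 'I_N | (x < q)%N]); last first.
  by apply/finset.setP => k; rewrite !inE ltn_ord/= among_topE.
rewrite on_card_preimset; last exact/onW_bij/injF_bij/rank_inj.
exact: card_ord_lt.
Qed.

(** Double counting of the pairs (s, k) with k < n: each of these n positions is selected by equally
    many permutations. *)
Lemma sum_among_top N n q (u : 'I_N.+1 -> R) : (0 < n <= N.+1)%N ->
  (n * \sum_(s : 'S_N.+1) among_top n q (u \o s) ord0 =
   \sum_(s : 'S_N.+1) #|[set k : 'I_N.+1 | (k < n)%N && among_top n q (u \o s) k]|)%N.
Proof.
move=> /andP[n0 nN].
(* Composition with a transposition makes the first n positions equivalent. *)
have aux (k : 'I_N.+1) : (k < n)%N ->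
    (\sum_(s : 'S_N.+1) among_top n q (u \o s) ord0 =
     \sum_(s : 'S_N.+1) among_top n q (u \o s) k)%N.
  move=> kn; rewrite (reindex_inj (mulgI (tperm ord0 k)))/=.
  apply: eq_bigr => s _; congr (nat_of_bool (_ <= _)%N).
  (* The transposition carries one counted set onto the other: it preserves the first [n] positions
     because [ord0] and [k] both lie among them. *)
  rewrite -[RHS](card_imset _ (@perm_inj _ (tperm ord0 k))).
  apply: eq_card => j; rewrite inE; apply/andP/imsetP => [[jn uj]|[l]].
    exists (tperm ord0 k j); last by rewrite tpermK.
    rewrite inE; move: uj; rewrite /= !permM tpermL => ->; rewrite andbT.
    by case: tpermP => // ->.
  rewrite inE => /andP[ln ul] ->; split; first by case: tpermP => // ->.
  by rewrite /= !permM tpermL tpermK.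
under [RHS]eq_bigr => s _.
  rewrite -sum1_card (eq_bigl
    (fun k : 'I_N.+1 => (k < n)%N && among_top n q (u \o s) k)).
    rewrite big_mkcondr/=.
    over.
  by move=> k; rewrite inE.
rewrite exchange_big/= (eq_bigr (fun=>
  \sum_(s : 'S_N.+1) among_top n q (u \o s) ord0)%N).
  rewrite sum_nat_const; congr (_ * _)%N.
  rewrite -[LHS](card_ord_lt nN); by apply: eq_card => x; rewrite inE.
move=> k kn; rewrite (aux k kn); apply: eq_bigr => s _.
by case: among_top.
Qed.

(** A product of three transpositions, each sending one point to its target and fixing the targets
    already reached. *)
Lemma ex_perm3 (T : finType) (a1 a2 a3 b1 b2 b3 : T) :
  uniq [:: a1; a2; a3] -> uniq [:: b1; b2; b3] ->
  exists s : {perm T}, [/\ s a1 = b1, s a2 = b2 & s a3 = b3].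
Proof.
rewrite /= !inE !negb_or !andbT => /andP[/andP[a12 a13] a23] /andP[/andP[b12 b13] b23].
pose s1 := tperm a1 b1; pose s2 := tperm (s1 a2) b2.
have s1a : s1 a1 = b1 by rewrite tpermL.
have s2b : s2 b1 = b1.
  by rewrite tpermD// ?[b2 == _]eq_sym// -s1a (inj_eq perm_inj) eq_sym.
pose s12 : {perm T} := (s1 * s2)%g; pose s3 := tperm (s12 a3) b3.
have e1 : s12 a1 = b1 by rewrite permM s1a.
have e2 : s12 a2 = b2 by rewrite permM tpermL.
exists (s12 * s3)%g; rewrite !(permM s12 s3) e1 e2; split; last by rewrite tpermL.
- by rewrite tpermD// ?[b3 == _]eq_sym// -e1 (inj_eq perm_inj) eq_sym.
- by rewrite tpermD// ?[b3 == _]eq_sym// -e2 (inj_eq perm_inj) eq_sym.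
Qed.

(** Up to the factor (N+1)!, the expectation over a uniformly random permutation with the values [u]
    held fixed. *)
Definition top_sum (g : R -> R) N n q (u : 'I_N.+1 -> R) : R :=
  \sum_(s : 'S_N.+1) (among_top n q (u \o s) ord0)%:R * g (u (s ord0)).

(** A Neyman-Pearson comparison: the rule on the right selects exactly the values above a threshold
    and has at least the total mass of the rule on the left, while [g] is positive and
    increasing. *)
Lemma top_sum_lt (g : R -> R) N m q (u : 'I_N.+1 -> R) :
  (forall x, 0 < g x) -> {homo g : x y / x < y} -> injective u ->
  (1 < m)%N -> (0 < q)%N -> N.+1 = (q.+1 * m)%N ->
  top_sum g (q * m) q u < top_sum g N.+1 q.+1 u.
Proof.
move=> g0 g_incr u_inj m1 q0 NE; set n := (q * m)%N.
have [qN q1N] : (q < N.+1)%N /\ (q.+1 < N.+1)%N by split; nia.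
have n0N : (0 < n <= N.+1)%N by apply/andP; split; nia.
have us_inj (s : 'S_N.+1) : injective (u \o s).
  by apply: inj_comp => //; exact: perm_inj.
(* As [nb_above] starts at 0, [i0] carries the (q+1)-st largest entry and [i1] the (q+2)-nd. *)
have [i0 i0E] := nb_above_surj u_inj qN.
have [i1 i1E] := nb_above_surj u_inj q1N.
have nb_perm (s : 'S_N.+1) i : nb_above (u \o s) i = nb_above u (s i).
  rewrite /nb_above -[RHS](on_card_preimset (f := s)); last first.
    by apply: onW_bij; exact: injF_bij perm_inj.
  by apply: eq_card => j; rewrite !inE.
pose a (s : 'S_N.+1) : R := (among_top n q (u \o s) ord0)%:R.
pose b (s : 'S_N.+1) : R := (among_top N.+1 q.+1 (u \o s) ord0)%:R.
have bE s : b s = (u i0 <= u (s ord0))%R%:R.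
  by rewrite /b among_topE// nb_perm ltnS -i0E nb_above_le.
have g_le x y : x <= y -> g x <= g y by move/ltW_homo : g_incr; exact.
have sum_cst c : (c * #|{: {perm 'I_N.+1}}| = \sum_(s : 'S_N.+1) c)%N.
  by rewrite sum_nat_const mulnC; congr (_ * _)%N; apply: eq_card.
(* At most [q] of the [q * m] positions are selected, a fraction of at most 1/m; for [b] it is
   exactly [q.+1] out of [q.+1 * m]. *)
have a_sum : m%:R * \sum_s a s <= (#|{: {perm 'I_N.+1}}|)%:R.
  rewrite -natr_sum -natrM ler_nat -(leq_pmul2l q0) mulnA sum_among_top//.
  rewrite sum_cst.
  apply: leq_sum => s _.
  exact: card_among_top_le.
have b_sum : m%:R * \sum_s b s = (#|{: {perm 'I_N.+1}}|)%:R.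
  rewrite -natr_sum -natrM; congr _%:R; apply/eqP.
  rewrite -(eqn_pmul2l (ltn0Sn q)) mulnA -NE sum_among_top ?leqnn//.
  rewrite sum_cst.
  apply/eqP; apply: eq_bigr => s _.
  by apply: card_among_top => //; nia.
have ab_sum : 0 <= \sum_s (b s - a s).
  rewrite sumrB subr_ge0 -(ler_pM2l (_ : 0 < m%:R)) ?ltr0n; first by rewrite b_sum.
  exact: ltnW.
(* Both factors change sign at the threshold u i0, the (q+1)-st largest entry. *)
have term_ge0 s : 0 <= (b s - a s) * (g (u (s ord0)) - g (u i0)).
  rewrite bE /a; have [us|us] := leP (u i0) (u (s ord0)).
    rewrite mulr_ge0// ?subr_ge0 ?g_le//.
    by case: among_top; rewrite ?lexx// ler01.
  rewrite mulr_le0// ?subr_le0 ?ler0n//.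
  by rewrite ltW// g_incr.
(* Strictness: put the (q+2)-nd largest entry at position 0 and the two largest, [i2] and [i3], at
   positions [n] and [n.+1], which the smaller test does not see. There is room because m > 1, and
   [i1] differs from [i2] and [i3] because q > 0. *)
have [s [as1 bs0 us]] : exists s, [/\ a s = 1, b s = 0 & u (s ord0) < u i0].
  have [i2 i2E] := nb_above_surj u_inj (ltn0Sn N).
  have [i3 i3E] : exists i, nb_above u i = 1%N by apply: nb_above_surj => //; nia.
  have n1N : (n.+1 < N.+1)%N by nia.
  have nN : (n < N.+1)%N by nia.
  have [||s [s1 s2 s3]] := @ex_perm3 _ ord0 (Ordinal nN) (Ordinal n1N) i1 i2 i3.
    rewrite /= !inE -!val_eqE/=.
    by apply/and3P; split => //; [rewrite negb_or; apply/andP; split; lia|lia].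
    rewrite /= !inE !negb_or !andbT.
    have ne i j : nb_above u i != nb_above u j -> i != j by apply: contraNneq => ->.
    by rewrite !ne// ?i1E ?i2E ?i3E//; lia.
  have us : u (s ord0) < u i0.
    by rewrite s1 ltNge -nb_above_le i1E i0E -ltnNge.
  exists s; split => //; last by rewrite bE leNgt us.
  rewrite /a (_ : among_top _ _ _ _ = true)//; rewrite /among_top.
  have := among_topE q.+2 ord0 (us_inj s).
  rewrite nb_perm s1 i1E ltnSn /among_top.
  set B := [set _ | _]; set A := [set _ | _] => cB.
  (* [B] has at most [q.+2] elements and contains two positions beyond the first [n], which leaves
     at most [q] for [A]. *)
  have BA : (Ordinal nN |: (Ordinal n1N |: A)) \subset B.
    apply/fintype.subsetP => j; rewrite !inE ltn_ord/= => /or3P[/eqP->|/eqP->|/andP[_ //]].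
      by rewrite s1 s2 -nb_above_le i1E i2E.
    by rewrite s1 s3 -nb_above_le i1E i3E.
  have := leq_trans (fintype.subset_leq_card BA) (cB : is_true (_ <= _)%N).
  rewrite !cardsU1 !inE/= -!val_eqE/= ltnn/=.
  by rewrite ltnNge leqnSn/=; lia.
have : 0 < \sum_s (b s - a s) * (g (u (s ord0)) - g (u i0)).
  rewrite (bigD1 s)//= ltr_pwDl ?sumr_ge0// as1 bs0 sub0r mulN1r opprB.
  by rewrite subr_gt0 g_incr.
(* Dropping the threshold from the second factor adds [g (u i0)] times the sum in [ab_sum], which is
   nonnegative. *)
under eq_bigr do rewrite mulrBr.
rewrite sumrB -mulr_suml => lt0.
have := le_lt_trans (mulr_ge0 ab_sum (ltW (g0 (u i0))))
  (_ : _ < \sum_s (b s - a s) * g (u (s ord0))).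
rewrite -subr_gt0 => /(_ lt0).
under eq_bigr do rewrite mulrBl.
by rewrite sumrB subr_gt0.
Qed.

End top_entries.

(** * Quantiles of a list with mirrored entries *)

Section quantile.
Context (R : realType).
Implicit Types (L : seq R) (x t : R).

Lemma ex_max_seq L : L != [::] -> exists2 y, y \in L & forall z, z \in L -> z <= y.
Proof.
elim: L => // a [_ _|b L IH _].
  by exists a => [|z]; rewrite mem_seq1// => /eqP->.
have [//|y yL yP] := IH.
have [ay|ya] := leP a y.
  exists y => [|z]; first by rewrite inE yL orbT.
  by rewrite inE => /predU1P[->//|]; exact: yP.
exists a => [|z]; first exact: mem_head.
by rewrite inE => /predU1P[->//|/yP zy]; rewrite (le_trans zy)// ltW.
Qed.

(** Both sides amount to at least [size L - q] entries lying strictly below [x]. *)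
Lemma quantile_lt L t q x : t * (size L)%:R = (size L - q)%:R -> (q < size L)%N ->
  (quantile L t < x) = (count (fun y => x <= y)%R L <= q)%N.
Proof.
move=> tE qL.
have L0 : L != [::] by case: (L) qL.
have t1 : t <= 1.
  rewrite -(ler_pM2r (_ : 0 < (size L)%:R)) ?ltr0n ?(leq_ltn_trans _ qL)//.
  by rewrite mul1r tE ler_nat leq_subr.
have [_ good_q le_q] := quantileP L0 t1.
have := count_predC (fun y => x <= y) L.
rewrite (@eq_count _ (predC _) (fun y => y < x)); last by move=> y; rewrite /= -ltNge.
move=> sizeE.
have sizeB :
    (size L - q <= count (fun y => y < x)%R L)%N =
    (count (fun y => x <= y)%R L <= q)%N.
  by rewrite -sizeE leq_subLR leq_add2r.
apply/idP/idP => [qx|].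
  have : (count (fun y => y <= quantile L t)%R L <= count (fun y => y < x)%R L)%N.
    by apply: sub_count => y /= /le_lt_trans; exact.
  by rewrite -sizeB; apply: leq_trans; rewrite -(ler_nat R) -tE.
rewrite -sizeB => cq.
(* The largest entry [y] below [x], which exists since [q < size L], satisfies the quantile
   condition, so the quantile is at most [y]. *)
have : [seq y <- L | y < x] != [::].
  by rewrite -size_eq0 size_filter -lt0n (leq_trans _ cq) ?subn_gt0.
move=> /ex_max_seq[y]; rewrite mem_filter => /andP[yx yL] ymax.
apply: le_lt_trans yx; apply: le_q => //; rewrite tE ler_nat.
apply: (leq_trans cq).
rewrite (@eq_in_count _ _ (fun z => (z < x) && (z <= y))%R).
  by apply: sub_count => z /andP[].
move=> z zL; case: ltP => //= zx; apply/esym/ymax.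
by rewrite mem_filter zx.
Qed.

(** For x > 0 at most one entry of a mirrored pair reaches [x], and one does exactly when the
    absolute value does. Estimates are numbered from 1, positions from 0. *)
Lemma count_mirrored (v : nat -> R) N n x : 0 < x -> (n <= N)%N ->
  count (fun y => x <= y)%R (flatten [seq [:: v j; - v j] | j <- iota 1 n]) =
  #|[set j : 'I_N | (j < n)%N && (x <= `|v j.+1|)%R]|.
Proof.
move=> x0 nN; rewrite count_flatten sumnE 2!big_map.
transitivity (\sum_(0 <= j < n) (x <= `|v j.+1|)%R)%N.
  rewrite /index_iota subn0 -[1%N]addn0 iotaDl big_map.
  apply: eq_bigr => j _; rewrite /= addn0 add1n ler_normr.
  case: (leP x (v j.+1)) => //= xv; case: (leP x _) => // xv'; exfalso.
  by move: x0; lra.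
rewrite big_mkord (big_ord_widen N (fun j => (x <= `|v j.+1|)%R : nat) nN).
rewrite -sum1_card [RHS](eq_bigl (fun j : 'I_N => (j < n)%N && (x <= `|v j.+1|)%R)).
  by rewrite [RHS]big_mkcondr; apply: eq_bigr => j _; case: ifP.
by move=> j; rewrite inE.
Qed.

Lemma count_mirrored_le0 (v : nat -> R) n x : x <= 0 ->
  (n <= count (fun y => x <= y)%R (flatten [seq [:: v j; - v j] | j <- iota 1 n]))%N.
Proof.
move=> x0; rewrite count_flatten sumnE 2!big_map -[leqLHS](size_iota 1 n).
rewrite -sum1_size; apply: leq_sum => j _ /=.
by case: (leP x (v j)) => //= xv; case: leP => // xv'; exfalso; lra.
Qed.

(** If the observed value is not positive, each of the [n] pairs has an entry at least as large, and
    q < n excludes rejection. *)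
Lemma lt_quantile_mirrored (v : nat -> R) t N n q :
  (n <= N.+1)%N -> (0 < q < n)%N -> t * (n.*2)%:R = (n.*2 - q)%:R ->
  (quantile (flatten [seq [:: v j; - v j] | j <- iota 1 n]) t < v 1%N) =
  (0 < v 1%N) && among_top n q (fun j : 'I_N.+1 => `|v j.+1|) ord0.
Proof.
move=> nN /andP[q0 qn] tE; set L := flatten _.
have sizeL : size L = n.*2.
  by rewrite -[in RHS](size_iota 1 n) /L; elim: (iota 1 n) => //= a s ->.
rewrite (@quantile_lt _ _ q) ?sizeL//; last by lia.
have [v0|v0] /= := ltP 0 (v 1%N); last first.
  by apply/negbTE; rewrite -ltnNge (leq_trans qn)// count_mirrored_le0.
rewrite (count_mirrored _ v0 nN) /among_top; congr (_ <= _)%N.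
by apply: eq_card => j; rewrite !inE (gtr0_norm v0).
Qed.

End quantile.

Local Open Scope classical_set_scope.

(** * Laws of independent identically distributed families *)

Section iid_families.
Local Open Scope ereal_scope.
Context (R : realType).

(** One product formula on full boxes encodes independence and the common marginal together; when
    [nu] is a probability, an index is left free by choosing [setT] there. *)
Definition iid_law d (T : measurableType d) (mu : set T -> \bar R) (k : nat)
    (nu : set R -> \bar R) (X : 'I_k -> T -> R) :=
  forall A : 'I_k -> set R, (forall i, measurable (A i)) ->
    mu [set w | forall i, A i (X i w)] = \prod_(i < k) nu (A i).

Lemma measurable_vector d (T : measurableType d) k (X : 'I_k -> T -> R) :
  (forall i, measurable_fun setT (X i)) ->
  measurable_fun setT (fun w => [tuple X i w | i < k]).
Proof.
move=> mX; apply/measurable_fun_tnthP => i.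
by apply: eq_measurable_fun (mX i) => w _; rewrite /= tnth_mktuple.
Qed.

Lemma measurable_box d (T : measurableType d) k (X : 'I_k -> T -> R)
    (A : 'I_k -> set R) :
  (forall i, measurable_fun setT (X i)) -> (forall i, measurable (A i)) ->
  measurable [set w | forall i, A i (X i w)].
Proof.
move=> mX mA.
rewrite (_ : mkset _ = \big[setI/setT]_(i < k) (X i @^-1` A i)).
  apply: bigsetI_measurable => i _; rewrite -[X in measurable X]setTI.
  exact: mX.
rewrite -bigcap_seq; apply/seteqP; split => x /=.
  by move=> h i _; exact: h.
by move=> h i; apply: h => /=; rewrite mem_index_enum.
Qed.

Lemma boxes_generate k :
  @measurable _ (k.-tuple R) =
  <<s [set [set x : k.-tuple R | forall i, A i (tnth x i)]
      | A in [set A : 'I_k -> set R | forall i, measurable (A i)]] >>.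
Proof.
apply/seteqP; split.
  apply: smallest_sub; first exact: smallest_sigma_algebra.
  rewrite -bigcup_seq => B [i _] [A mA <-].
  apply: sub_sigma_algebra; exists (fun j => if j == i then A else setT).
    by move=> j; case: ifP.
  apply/seteqP; split => x /=.
    by move=> /(_ i); rewrite eqxx.
  by move=> [_ Ax] j; case: eqP => // ->.
apply: smallest_sub; first exact: sigma_algebra_measurable.
move=> _ [A mA <-].
apply: (measurable_box (X := fun i (x : k.-tuple R) => tnth x i)) => // i.
exact: measurable_tnth.
Qed.

(** Boxes form a generating class stable under intersection, so two image measures that agree on
    them are equal. This transfers integrals between probability spaces and between transformed
    families. *)
Lemma iid_law_unique d1 d2 (T1 : measurableType d1) (T2 : measurableType d2)
    (mu1 : probability T1 R) (mu2 : probability T2 R) k (nu : set R -> \bar R)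
    (X : 'I_k -> T1 -> R) (Y : 'I_k -> T2 -> R) :
  (forall i, measurable_fun setT (X i)) ->
  (forall i, measurable_fun setT (Y i)) ->
  iid_law mu1 nu X -> iid_law mu2 nu Y ->
  forall F : k.-tuple R -> \bar R, measurable_fun [set: k.-tuple R] F ->
    (forall x, 0 <= F x) ->
  \int[mu1]_w F [tuple X i w | i < k] = \int[mu2]_w F [tuple Y i w | i < k].
Proof.
move=> mX mY lX lY F mF F0.
have mX' := measurable_vector mX; have mY' := measurable_vector mY.
pose fX : {mfun T1 >-> k.-tuple R} :=
  HB.pack (fun w => [tuple X i w | i < k]) (isMeasurableFun.Build _ _ _ _ _ mX').
pose fY : {mfun T2 >-> k.-tuple R} :=
  HB.pack (fun w => [tuple Y i w | i < k]) (isMeasurableFun.Build _ _ _ _ _ mY').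
transitivity (\int[distribution mu1 fX]_x F x).
  by rewrite ge0_integral_distribution.
transitivity (\int[distribution mu2 fY]_x F x); last first.
  by rewrite ge0_integral_distribution.
apply: eq_measure_integral.
move=> B mB _.
apply: (measure_unique _ (fun=> setT) (boxes_generate k)) mB.
- move=> _ _ [A mA <-] [C mC <-]; exists (fun i => A i `&` C i).
    by move=> i; exact: measurableI.
  apply/seteqP; split=> x /=.
    by move=> h; split=> i; have [] := h i.
  by move=> [h1 h2] i; split.
- move=> _; exists (fun=> setT) => //.
  by apply/seteqP; split.
- by rewrite bigcup_const//; exists 0%N.
- move=> _ [A mA <-].
  have aux d (T : measurableType d) (mu : probability T R) (W : 'I_k -> T -> R) :
      iid_law mu nu W ->
      mu [set w | forall i, A i (tnth [tuple W i w | i < k] i)] =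
      \prod_(i < k) nu (A i).
    move=> /(_ A mA) <-; congr (mu _); apply/seteqP; split => w /= h i.
      by move: (h i); rewrite tnth_mktuple.
    by rewrite tnth_mktuple.
  by rewrite [LHS]aux// [RHS]aux.
- by move=> _; rewrite (le_lt_trans (probability_le1 _ _))// ltry.
Qed.

(** Replacing one coordinate by a fresh independent copy on a product space makes it accessible to
    Tonelli's theorem. *)
Lemma iid_law_resample d (T : measurableType d) (mu : probability T R) k
    (nu : probability (measurableTypeR R) R) (X : 'I_k -> T -> R) (i : 'I_k) :
  (forall i, measurable_fun setT (X i)) ->
  iid_law mu nu X ->
  iid_law (nu \x mu) nu
    (fun j (z : measurableTypeR R * T) => if j == i then z.1 else X j z.2).
Proof.
move=> mX lX A mA.
pose A' j := if j == i then setT else A j.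
have mA' j : measurable (A' j) by rewrite /A'; case: ifP.
rewrite (_ : mkset _ = A i `*` [set w | forall j, A' j (X j w)]); last first.
  apply/seteqP; split=> -[a w] /=.
    move=> h; split; first by have := h i; rewrite eqxx.
    by move=> j; have := h j; rewrite /A'; case: ifP.
  by move=> [h1 h2] j; have := h2 j; rewrite /A'; case: eqP => [->|].
have mAi : measurable (A i : set (measurableTypeR R)) := mA i.
rewrite product_measure1E//; last exact: measurable_box.
transitivity (nu (A i) * \prod_(j < k) nu (A' j)).
  by congr (_ * _); exact: lX.
rewrite (bigD1 i)//= [RHS](bigD1 i)//= {1}/A' eqxx probability_setT mul1e.
congr (_ * _); apply: eq_bigr => j ji.
by rewrite /A' (negbTE ji).
Qed.

End iid_families.

(** * Shifts of Gaussian families *)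

Section gaussian_shift.
Local Open Scope ereal_scope.
Context (R : realType).
Local Notation lambda := (@lebesgue_measure R).
Local Notation gauss := (normal_prob (0 : R) 1).

(** The explicit density agrees almost everywhere with the Radon-Nikodym derivative, for which the
    change of variables is known. *)
Lemma ge0_integral_density d (T : measurableType d)
    (nu : {finite_measure set T -> \bar R})
    (mu : {sigma_finite_measure set T -> \bar R}) (g f : T -> \bar R) :
  measurable_fun setT g -> (forall x, 0 <= g x) ->
  (forall A, measurable A -> nu A = \int[mu]_(x in A) g x) ->
  measurable_fun setT f -> (forall x, 0 <= f x) ->
  \int[nu]_x f x = \int[mu]_x (f x * g x).
Proof.
move=> mg g0 nuE mf f0.
have numu : nu `<< mu.
  apply/null_content_dominatesP => A mA muA0; rewrite nuE//.
  by apply: null_set_integral => //; exact: measurable_funTS.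
rewrite -(Radon_Nikodym_SigmaFinite.change_of_variables numu)//.
have ig : mu.-integrable setT g.
  apply/integrableP; split => //.
  under eq_integral do rewrite gee0_abs//.
  rewrite -nuE//; exact: fin_num_fun_lty.
apply: ae_eq_integral => //.
- apply: emeasurable_funM => //.
  exact/measurable_int/Radon_Nikodym_SigmaFinite.f_integrable.
- exact: emeasurable_funM.
- apply: ae_eqe_mul2l => /=; apply: integral_ae_eq => //.
    exact: Radon_Nikodym_SigmaFinite.f_integrable.
  by move=> E _ mE; rewrite -nuE// -Radon_Nikodym_SigmaFinite.f_integral.
Qed.

Lemma ge0_integral_normal_prob (m s : R) (f : R -> \bar R) :
  measurable_fun setT f -> (forall x, 0 <= f x) ->
  \int[normal_prob m s]_x f x = \int[lambda]_x (f x * (normal_pdf m s x)%:E).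
Proof.
move=> mf f0; apply: ge0_integral_density => //.
- by apply/measurable_EFinP; exact: measurable_normal_pdf.
- by move=> x; rewrite lee_fin normal_pdf_ge0.
Qed.

Lemma ge0_integral_translation (c : R) (f : R -> \bar R) :
  measurable_fun setT f -> (forall x, 0 <= f x) ->
  \int[lambda]_x f (x + c)%R = \int[lambda]_x f x.
Proof.
move=> mf f0.
pose tr (x : measurableTypeR R) : measurableTypeR R := (x + c)%R.
have mtr : measurable_fun setT tr by exact: measurable_funD.
transitivity (\int[pushforward lambda tr]_x f x).
  by rewrite ge0_integral_pushforward.
apply: eq_measure_integral => A mA _; apply/esym.
apply: (@lebesgue_measure_unique R (pushforward lambda tr)) => //= _ [[a b]] _ <-.
rewrite /pushforward (_ : _ @^-1` _ = `](a - c)%R, (b - c)%R]%classic).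
  by rewrite !lebesgue_measure_itv/= !lte_fin ltrD2r -!EFinB opprB addrA subrK.
by apply/seteqP; split=> x /=; rewrite !in_itv/= ltrBlDr lerBrDr.
Qed.

Lemma normal_pdf_translation (c x : R) :
  normal_pdf 0%R 1%R (x - c) =
  (normal_pdf 0 1 x * expR (c * x - c ^+ 2 / 2))%R.
Proof.
rewrite !normal_pdfE// /normal_fun -mulrA -expRD; congr (_ * expR _)%R.
by field.
Qed.

(** The one-dimensional Cameron-Martin formula: Lebesgue measure is translation invariant, and the
    exponential is the ratio of the two normal densities. *)
Lemma gauss_shift (c : R) (f : R -> \bar R) :
  measurable_fun setT f -> (forall x, 0 <= f x) ->
  \int[gauss]_x f (x + c)%R =
  \int[gauss]_x (f x * (expR (c * x - c ^+ 2 / 2))%:E).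
Proof.
move=> mf f0.
have mc : measurable_fun setT (fun x : R => x + c)%R.
  exact: measurable_funD.
have me : measurable_fun setT (fun x : R => (expR (c * x - c ^+ 2 / 2))%:E).
  apply/measurable_EFinP/measurableT_comp => //.
  by apply: measurable_funB => //; exact: measurable_funM.
rewrite !ge0_integral_normal_prob//; last 3 first.
- by apply: emeasurable_funM.
- by move=> x; rewrite mule_ge0// lee_fin expR_ge0.
- exact: measurableT_comp.
rewrite -[RHS](ge0_integral_translation c); last 2 first.
- apply: emeasurable_funM; first exact: emeasurable_funM.
  by apply/measurable_EFinP; exact: measurable_normal_pdf.
- move=> x; rewrite mule_ge0// ?mule_ge0// ?lee_fin ?expR_ge0//.
  exact: normal_pdf_ge0.
apply: eq_integral => x _; rewrite -muleA -EFinM; congr (_ * _%:E).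
by rewrite mulrC -normal_pdf_translation addrK.
Qed.

End gaussian_shift.

(** * Integrating out one coordinate of an i.i.d. family *)

Section resampling.
Local Open Scope ereal_scope.
Context (R : realType) d (T : measurableType d) (mu : probability T R).
Local Notation gauss := (normal_prob (0 : R) 1).

Lemma measurable_slice k (i : 'I_k) (y : 'I_k -> R) :
  measurable_fun setT (fun t : R => [tuple if j == i then t else y j | j < k]).
Proof.
apply: (measurable_vector (X := fun j t => if j == i then t else y j)) => j.
by case: eqP.
Qed.

Lemma resampled_integral k (nu : probability (measurableTypeR R) R) (X : 'I_k -> T -> R)
    (i : 'I_k) (F : k.-tuple R -> \bar R) :
  (forall i, measurable_fun setT (X i)) -> iid_law mu nu X ->
  measurable_fun setT F -> (forall x, 0 <= F x) ->
  \int[mu]_w F [tuple X j w | j < k] =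
  \int[mu]_w \int[nu]_t F [tuple if j == i then t else X j w | j < k].
Proof.
move=> mX lX mF F0.
pose Y (j : 'I_k) (z : measurableTypeR R * T) := if j == i then z.1 else X j z.2.
have mY j : measurable_fun setT (Y j).
  rewrite /Y; case: eqP => _; first exact: (@measurable_fst _ _ (measurableTypeR R) T).
  exact: (measurableT_comp (mX j) measurable_snd).
rewrite (iid_law_unique mX mY lX (iid_law_resample i mX lX) mF F0).
rewrite [LHS]fubini_tonelli2//.
exact: (measurableT_comp mF (measurable_vector mY)).
Qed.

(** Coordinate [i] is integrated out first on both sides, which reduces the claim to [gauss_shift]
    with the other coordinates frozen. *)
Lemma girsanov k (X : 'I_k -> T -> R) (i : 'I_k) (c : R)
    (F : k.-tuple R -> \bar R) :
  (forall i, measurable_fun setT (X i)) -> iid_law mu gauss X ->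
  measurable_fun setT F -> (forall x, 0 <= F x) ->
  \int[mu]_w F [tuple (X j w + (if j == i then c else 0))%R | j < k] =
  \int[mu]_w (F [tuple X j w | j < k] *
              (expR (c * X i w - c ^+ 2 / 2))%:E).
Proof.
move=> mX lX mF F0.
pose sh (x : k.-tuple R) :=
  [tuple (tnth x j + (if j == i then c else 0))%R | j < k].
have msh : measurable_fun setT sh.
  apply: (@measurable_vector _ _ _ _ (fun j (x : k.-tuple R) => tnth x j + _)%R) => j.
  by apply: measurable_funD => //; exact: measurable_tnth.
pose e (t : R) := (expR (c * t - c ^+ 2 / 2))%:E.
have me : measurable_fun setT e.
  apply/measurable_EFinP/measurableT_comp => //.
  by apply: measurable_funB => //; exact: measurable_funM.
transitivity (\int[mu]_w (F \o sh) [tuple X j w | j < k]).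
  apply: eq_integral => w _ /=; congr F.
  by apply: eq_from_tnth => j; rewrite !tnth_mktuple.
rewrite (resampled_integral i mX lX (F := F \o sh));
  [|exact: (measurableT_comp mF msh)|by move=> x; exact: F0].
transitivity (\int[mu]_w (fun x => F x * e (tnth x i)) [tuple X j w | j < k]);
    last first.
  by apply: eq_integral => w _; rewrite tnth_mktuple.
rewrite (resampled_integral i mX lX (F := fun x => F x * e (tnth x i)))//; last 2 first.
- apply: emeasurable_funM => //.
  by apply: measurableT_comp => //; exact: measurable_tnth.
- by move=> x; rewrite mule_ge0// lee_fin expR_ge0.
apply: eq_integral => w _ /=.
pose f t := F [tuple if j == i then t else X j w | j < k].
transitivity (\int[gauss]_t f (t + c)%R).
  apply: eq_integral => t _; congr F.
  apply: eq_from_tnth => j; rewrite !tnth_mktuple.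
  by case: eqP => // _; rewrite addr0.
rewrite gauss_shift;
  [|exact: (measurableT_comp mF (measurable_slice _ _))|by move=> t; exact: F0].
by apply: eq_integral => t _; rewrite tnth_mktuple eqxx.
Qed.

(** Lines parallel to axis [i] meet [D] in at most one point, and the normal law has no atoms. *)
Lemma iid_law_null k (X : 'I_k -> T -> R) (i : 'I_k) (D : set (k.-tuple R)) :
  (forall i, measurable_fun setT (X i)) -> iid_law mu gauss X ->
  measurable D ->
  (forall w, exists t0, forall t,
    D [tuple if j == i then t else X j w | j < k] -> t = t0) ->
  mu [set w | D [tuple X j w | j < k]] = 0.
Proof.
move=> mX lX mD Dt.
have mI : measurable_fun setT (EFin \o (\1_D : k.-tuple R -> R)).
  exact/measurable_EFinP/measurable_indic.
transitivity (\int[mu]_w (EFin \o \1_D) [tuple X j w | j < k]).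
  rewrite -[RHS]/(\int[mu]_w (\1_[set w | D [tuple X j w | j < k]] w)%:E).
  rewrite integral_indic ?setIT// -[X in measurable X]setTI.
  exact: (measurable_vector mX).
rewrite (resampled_integral i mX lX mI); last by move=> x; rewrite lee_fin.
apply: integral0_eq => w _.
have [t0 Dt0] := Dt w.
apply/eqP; rewrite eq_le integral_ge0//= andbT.
have g0 : gauss [set t0] = 0.
  have /null_content_dominatesP := normal_prob_dominates (0 : R) 1; apply => //.
  exact: lebesgue_measure_set1.
have -> : 0 = \int[gauss]_t (\1_[set t0] t)%:E.
  by rewrite integral_indic// setIT.
apply: ge0_le_integral => //.
- exact: (measurableT_comp mI (measurable_slice _ _)).
- exact/measurable_EFinP/measurable_indic.
- move=> t _; rewrite lee_fin !indicE.
  case: (boolP (_ \in D)) => //= /set_mem/Dt0 ->.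
  by rewrite mem_set.
Qed.

End resampling.

(** * Sign and permutation symmetries, and shifts of two coordinates *)

Section invariance.
Local Open Scope ereal_scope.
Context (R : realType).
Local Notation gauss := (normal_prob (0 : R) 1).
Local Notation lambda := (@lebesgue_measure R).

Lemma ge0_integral_opp (f : R -> \bar R) :
  measurable_fun setT f -> (forall x, 0 <= f x) ->
  \int[lambda]_x f (- x)%R = \int[lambda]_x f x.
Proof.
move=> mf f0.
pose op (x : measurableTypeR R) : measurableTypeR R := (- x)%R.
have mop : measurable_fun setT op by exact: measurable_funN.
transitivity (\int[pushforward lambda op]_x f x).
  by rewrite ge0_integral_pushforward.
by apply: eq_measure_integral => A mA _; exact: lebesgue_measureN.
Qed.

Lemma gauss_opp (A : set R) : measurable A -> gauss [set x | A (- x)%R] = gauss A.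
Proof.
move=> mA.
have mI : measurable_fun setT (EFin \o (\1_A : R -> R)).
  exact/measurable_EFinP/measurable_indic.
have mopp : measurable_fun setT (fun x : R => - x)%R by exact: measurable_funN.
have mA' : measurable [set x : R | A (- x)%R].
  by rewrite -[X in measurable X]setTI; exact: mopp.
have mpdf : measurable_fun setT (fun x : R => (normal_pdf 0 1 x)%:E).
  by apply/measurable_EFinP; exact: measurable_normal_pdf.
transitivity (\int[gauss]_x (\1_A (- x)%R)%:E).
  rewrite -[RHS]/(\int[gauss]_x (\1_[set x : R | A (- x)%R] x)%:E).
  by rewrite integral_indic ?setIT.
transitivity (\int[gauss]_x (\1_A x)%:E); last by rewrite integral_indic ?setIT.
rewrite !ge0_integral_normal_prob//; last exact: (measurableT_comp mI mopp).
rewrite -[RHS]ge0_integral_opp; last 2 first.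
- exact: emeasurable_funM.
- by move=> x; rewrite mule_ge0// lee_fin// normal_pdf_ge0.
apply: eq_integral => x _; congr (_ * _%:E).
by rewrite !normal_pdfE// /normal_fun !subr0 sqrrN.
Qed.

Context d (T : measurableType d) (mu : probability T R).

Lemma iid_law_opp k (X : 'I_k -> T -> R) :
  iid_law mu gauss X -> iid_law mu gauss (fun i w => - X i w)%R.
Proof.
move=> lX A mA.
have mA' i : measurable [set x : R | A i (- x)%R].
  rewrite -[X in measurable X]setTI.
  by apply: (_ : measurable_fun setT (fun x : R => - x)%R) => //; exact: measurable_funN.
transitivity (\prod_(i < k) gauss [set x | A i (- x)%R]); first exact: lX.
by apply: eq_bigr => i _; rewrite gauss_opp.
Qed.

Lemma iid_law_perm k (nu : set R -> \bar R) (X : 'I_k -> T -> R) (s : 'S_k) :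
  iid_law mu nu X -> iid_law mu nu (fun i => X (s i)).
Proof.
move=> lX A mA.
transitivity (\prod_(i < k) nu (A (s^-1%g i))).
  rewrite -(lX _ (fun i => mA _)); congr (mu _); apply/seteqP; split=> w /= h i.
    by have := h (s^-1%g i); rewrite permKV.
  by have := h (s i); rewrite permK.
rewrite (reindex_inj (@perm_inj _ s))/=.
by apply: eq_bigr => i _; rewrite permK.
Qed.

(** Two successive one-coordinate shifts; as the indices differ, the weight produced by the first is
    unaffected by the second. *)
Lemma girsanov2 k (X : 'I_k -> T -> R) (i1 i2 : 'I_k) (c1 c2 : R)
    (F : k.-tuple R -> \bar R) :
  i1 != i2 ->
  (forall i, measurable_fun setT (X i)) -> iid_law mu gauss X ->
  measurable_fun setT F -> (forall x, 0 <= F x) ->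
  \int[mu]_w F [tuple (X j w + ((if j == i1 then c1 else 0) +
                                (if j == i2 then c2 else 0)))%R | j < k] =
  \int[mu]_w (F [tuple X j w | j < k] *
    (expR (c1 * X i1 w + c2 * X i2 w - (c1 ^+ 2 + c2 ^+ 2) / 2))%:E).
Proof.
move=> i12 mX lX mF F0.
pose sh (x : k.-tuple R) :=
  [tuple (tnth x j + (if j == i1 then c1 else 0))%R | j < k].
have msh : measurable_fun setT sh.
  apply: (@measurable_vector _ _ _ _ (fun j (x : k.-tuple R) => tnth x j + _)%R) => j.
  by apply: measurable_funD => //; exact: measurable_tnth.
pose e (x : k.-tuple R) := (expR (c2 * tnth x i2 - c2 ^+ 2 / 2))%:E.
have me : measurable_fun setT e.
  apply/measurable_EFinP/measurableT_comp => //.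
  by apply: measurable_funB => //; apply: measurable_funM => //; exact: measurable_tnth.
have e0 x : 0 <= e x by rewrite lee_fin expR_ge0.
transitivity (\int[mu]_w (F \o sh)
    [tuple (X j w + (if j == i2 then c2 else 0))%R | j < k]).
  apply: eq_integral => w _ /=; congr F.
  by apply: eq_from_tnth => j; rewrite !tnth_mktuple addrAC addrA.
rewrite (girsanov i2 c2 mX lX (measurableT_comp mF msh) (fun x => F0 (sh x))).
pose G x := F x * e x.
transitivity (\int[mu]_w G [tuple (X j w + (if j == i1 then c1 else 0))%R | j < k]).
  apply: eq_integral => w _; rewrite /G /e tnth_mktuple eq_sym (negbTE i12) addr0.
  by congr (F _ * _); apply: eq_from_tnth => j; rewrite !tnth_mktuple.
rewrite (girsanov i1 c1 mX lX)//; last 2 first.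
- exact: emeasurable_funM.
- by move=> x; rewrite mule_ge0.
apply: eq_integral => w _; rewrite /G /e tnth_mktuple -muleA; congr (_ * _).
by rewrite -EFinM -expRD; congr (expR _)%:E; field.
Qed.

End invariance.

(** * Strict monotonicity of the integral *)

Section strict_integral.
Local Open Scope ereal_scope.
Context (R : realType) d (T : measurableType d) (mu : probability T R).

Lemma integral_lt_ae (f g : T -> R) (N : set T) :
  measurable_fun setT f -> measurable_fun setT g ->
  (forall x, 0 <= f x)%R -> (forall x, 0 <= g x)%R ->
  \int[mu]_x (f x)%:E < +oo ->
  measurable N -> mu N = 0 -> (forall x, ~ N x -> f x < g x)%R ->
  \int[mu]_x (f x)%:E < \int[mu]_x (g x)%:E.
Proof.
move=> mf mg f0 g0 foo mN N0 fg.
(* [h] equals [g] off [N], and [h - f] is nonnegative everywhere. If its integral vanished, [f]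
   would equal [g] almost everywhere and the whole space would be null. *)
pose h x := Num.max (f x) (g x).
have mh : measurable_fun setT h by exact: measurable_maxr.
have fh x : (f x <= h x)%R by rewrite le_max lexx.
have -> : \int[mu]_x (g x)%:E = \int[mu]_x (h x)%:E.
  apply: ae_eq_integral => //; [exact/measurable_EFinP|exact/measurable_EFinP|].
  exists N; split => // x /= gh; apply: contrapT => Nx; apply: gh => _.
  by rewrite /h max_r// ltW// fg.
have -> : \int[mu]_x (h x)%:E = \int[mu]_x (f x)%:E + \int[mu]_x (h x - f x)%:E.
  rewrite -ge0_integralD//.
  - by apply: eq_integral => x _; rewrite -EFinD addrC subrK.
  - by move=> x _; rewrite lee_fin.
  - exact/measurable_EFinP.
  - by move=> x _; rewrite lee_fin subr_ge0.
  - exact/measurable_EFinP/measurable_funB.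
rewrite lteDl; last by rewrite ge0_fin_numE// integral_ge0// => x _; rewrite lee_fin.
rewrite lt0e integral_ge0 ?andbT; last by move=> x _; rewrite lee_fin subr_ge0.
apply/eqP => int0.
have mhf : measurable_fun setT (fun x => (h x - f x)%:E).
  exact/measurable_EFinP/measurable_funB.
have : ae_eq mu setT (fun x => (h x - f x)%:E) (cst 0).
  apply/(ae_eq_integral_abs mu measurableT mhf).
  rewrite -int0; apply: eq_integral => x _.
  by rewrite gee0_abs// lee_fin subr_ge0.
move=> [M [mM M0 subM]].
have : mu (N `|` M) = 0 by exact: null_set_setU.
rewrite (_ : N `|` M = setT).
  by rewrite probability_setT => /eqP; rewrite onee_eq0.
apply/seteqP; split => // x _; have [Nx|Nx] := pselect (N x); [by left|right].
apply: subM => /= /(_ I)/eqP; rewrite eqe subr_eq0 => /eqP hf.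
have fgx := fg x Nx; move: hf fgx; rewrite /h => + fgx.
by rewrite (max_r (ltW fgx)) => e; move: fgx; rewrite e ltxx.
Qed.

End strict_integral.

(** * The power as a symmetric expectation *)

Section measurable_top.
Context (R : realType) d (T : measurableType d).

Lemma measurable_natr_bool (b : T -> bool) :
  measurable_fun setT b -> measurable_fun setT (fun w => (b w)%:R : R).
Proof.
move=> mb; have mf : measurable_fun setT (fun c : bool => c%:R : R) by move=> _ B _.
exact: (measurableT_comp mf mb).
Qed.

Lemma measurable_among_top N n q (u : 'I_N -> T -> R) i :
  (forall j, measurable_fun setT (u j)) ->
  measurable_fun setT (fun w => among_top n q (u ^~ w) i).
Proof.
move=> mu.
rewrite (_ : (fun _ => _) = fun w =>
    \sum_(j < N) ((j < n)%N && (u i w <= u j w))%:R <= q%:R :> R); last first.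
  apply/funext => w; rewrite /among_top -(ler_nat R) -sum1_card natr_sum.
  congr (_ <= _); rewrite big_mkcond/=; apply: eq_bigr => j _.
  by rewrite inE; case: (_ && _).
apply: measurable_fun_ler => //; apply: measurable_sum => j.
apply: measurable_natr_bool; apply: measurable_and => //.
exact: measurable_fun_ler.
Qed.

(** Position [ord0] is the allocation that is run, numbered 1 in the model. *)
Definition rejects N n q (y : 'I_N.+1 -> R) : bool :=
  (0 < y ord0) && among_top n q (fun j => `|y j|) ord0.

Lemma measurable_rejects N n q (y : 'I_N.+1 -> T -> R) :
  (forall j, measurable_fun setT (y j)) ->
  measurable_fun setT (fun w => rejects n q (y ^~ w)).
Proof.
move=> my; apply: measurable_and; first exact: measurable_fun_ltr.
apply: (@measurable_among_top _ n q (fun j w => `|y j w|) ord0) => j.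
exact: measurableT_comp.
Qed.

End measurable_top.

Section model.
Context (R : realType) (rho gamma : R).
Local Notation gauss := (normal_prob (0 : R) 1).

(** The estimates without treatment effect, as functions of the noise vector; its coordinate 0 is
    the common factor. *)
Definition equicorrelated N (x : N.+2.-tuple R) (j : 'I_N.+1) : R :=
  Num.sqrt rho * tnth x ord0 + Num.sqrt (1 - rho) * tnth x (lift ord0 j).

Lemma measurable_equicorrelated N (j : 'I_N.+1) :
  measurable_fun setT (fun x : N.+2.-tuple R => equicorrelated x j).
Proof.
by apply: measurable_funD; apply: measurable_funM => //; exact: measurable_tnth.
Qed.

(** [among_top] sees absolute values only, and exactly one of [y] and its negative is positive at
    [ord0] unless that entry vanishes. *)
Lemma rejects_opp N n q (y : 'I_N.+1 -> R) : (q < n <= N.+1)%N ->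
  (rejects n q y)%:R * expR (gamma * y ord0) +
  (rejects n q (fun j => - y j))%:R * expR (gamma * - y ord0) =
  (among_top n q (fun j => `|y j|) ord0)%:R * expR (gamma * `|y ord0|) :> R.
Proof.
move=> /andP[qn nN]; rewrite /rejects oppr_gt0.
rewrite (_ : among_top n q (fun j => `|- y j|) ord0 =
             among_top n q (fun j => `|y j|) ord0).
  have [y0|y0|y0] := ltgtP (y ord0) 0.
  - by rewrite /= mul0r add0r ltr0_norm.
  - by rewrite /= mul0r addr0 gtr0_norm.
  (* A zero entry has all the first [n] entries counted against it, and n > q. *)
  - rewrite /= !mul0r addr0 (_ : among_top _ _ _ _ = false) ?mul0r//.
    apply/negbTE; rewrite -ltnNge (leq_trans qn)// -[leqLHS](card_ord_lt nN).
    apply: subset_leq_card; apply/fintype.subsetP => j.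
    by rewrite !inE y0 normr0 normr_ge0 andbT.
by congr among_top; apply/funext => j; rewrite normrN.
Qed.

(* The shift of (Z_0, Z_1) that adds gamma to V_1 and rho gamma to the other
   V_j; it is gamma times the coefficient vector of V_1. *)
Definition effect_shift N (j : 'I_N.+2) : R :=
  (if j == ord0 then Num.sqrt rho * gamma else 0) +
  (if j == lift ord0 ord0 then Num.sqrt (1 - rho) * gamma else 0).

Definition shifted N (x : N.+2.-tuple R) : N.+2.-tuple R :=
  [tuple tnth x i + effect_shift i | i < N.+2].

Lemma measurable_shifted N : measurable_fun setT (@shifted N).
Proof.
apply: (measurable_vector
  (X := fun i (x : N.+2.-tuple R) => tnth x i + effect_shift i)) => i.
by apply: measurable_funD => //; exact: measurable_tnth.
Qed.

Lemma measurable_rejects_shifted N n q : measurable_fun setT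
  (fun x : N.+2.-tuple R => rejects n q (equicorrelated (shifted x))).
Proof.
apply: (@measurable_rejects _ _ _ _ n q (fun j x => equicorrelated (shifted x) j)) => j.
exact: (measurableT_comp (measurable_equicorrelated j) (@measurable_shifted N)).
Qed.

Context (rho_gt0 : 0 < rho) (rho_lt1 : rho < 1).

Lemma equicorrelated_shifted N (x : N.+2.-tuple R) (j : 'I_N.+1) :
  equicorrelated (shifted x) j =
  equicorrelated x j + (if j == ord0 then gamma else rho * gamma).
Proof.
rewrite /equicorrelated !tnth_mktuple /effect_shift eqxx (inj_eq lift_inj) add0r.
rewrite (_ : (ord0 == lift ord0 ord0 :> 'I_N.+2) = false)// addr0.
have s1 : Num.sqrt rho * Num.sqrt rho = rho by rewrite -expr2 sqr_sqrtr// ltW.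
have s2 : Num.sqrt (1 - rho) * Num.sqrt (1 - rho) = 1 - rho.
  by rewrite -expr2 sqr_sqrtr// subr_ge0 ltW.
by rewrite !mulrDr !mulrA s1; case: eqP => _; rewrite ?mulrA ?s2; ring.
Qed.

(** The noise vector may be longer than the test requires, so that both sample sizes can be read off
    one vector. *)
Lemma power_integral alpha N n q d (T : measurableType d) (P : probability T R)
    (Z : nat -> {RV P >-> R}) :
  (n <= N.+1)%N -> (0 < q < n)%N -> (1 - alpha) * (n.*2)%:R = (n.*2 - q)%:R ->
  power rho gamma alpha n Z =
  (\int[P]_w (rejects n q (equicorrelated (shifted [tuple Z i w | i < N.+2])))%:R%:E)%E.
Proof.
move=> nN qn alphaE; rewrite /power.
pose tup w := shifted [tuple Z i w | i < N.+2].
have mtup : measurable_fun setT (fun w => [tuple Z i w | i < N.+2]).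
  exact: (measurable_vector (X := fun i w => Z i w)).
have mrej : measurable_fun setT (fun w => rejects n q (equicorrelated (tup w))).
  exact: (measurableT_comp (@measurable_rejects_shifted N n q) mtup).
rewrite (_ : mkset _ = [set w | rejects n q (equicorrelated (tup w))]).
  transitivity (\int[P]_w (\1_[set w | rejects n q (equicorrelated (tup w))] w)%:E)%E.
    rewrite integral_indic ?setIT// -[X in measurable X]setTI.
    exact: (mrej measurableT [set true]).
  apply: eq_integral => w _; rewrite indicE; congr ((nat_of_bool _)%:R%:E).
  by apply/idP/idP => [/set_mem|h]; last exact: mem_set.
apply/funext => w; apply/propext => /=.
pose v j := estimate rho gamma Z j w.
have -> : reference_list rho gamma n Z w =
    flatten [seq [:: v j; - v j] | j <- iota 1 n] by [].
rewrite (lt_quantile_mirrored v nN qn alphaE) /rejects.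
have vE (j : 'I_N.+1) : v j.+1 = equicorrelated (tup w) j.
  by rewrite equicorrelated_shifted /equicorrelated !tnth_mktuple.
rewrite [X in 0 < X](vE ord0).
rewrite (_ : (fun j : 'I_N.+1 => `|v j.+1|) = (fun j => `|equicorrelated (tup w) j|))//.
by apply/funext => j; rewrite vE.
Qed.

Lemma iid_standard_normal_law n k d (T : measurableType d) (P : probability T R)
    (Z : nat -> {RV P >-> R}) : (k <= n.+1)%N ->
  iid_standard_normal n Z -> iid_law P gauss (fun i : 'I_k => Z i).
Proof.
move=> kn [ind normal] A mA.
pose A' (j : 'I_n.+1) := if insub (val j) is Some i then A i else setT.
have mA' j : measurable (A' j) by rewrite /A'; case: insub.
have A'E (i : 'I_k) : A' (widen_ord kn i) = A i by rewrite /A' /= valK.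
pose J := finset (fun j : 'I_n.+1 => (j < k)%N).
transitivity (\prod_(j in J) P (Z j @^-1` A' j))%E.
  rewrite -(ind J A' mA'); congr (P _); apply/seteqP; split => w /= h.
    move=> j; rewrite /= inE => jk; rewrite -[j](_ : widen_ord kn (Ordinal jk) = j).
      by rewrite /preimage /= A'E; exact: h.
    exact: val_inj.
  move=> i; have := h (widen_ord kn i); rewrite /preimage /= inE A'E; apply; exact: (ltn_ord i).
rewrite (eq_bigl (fun j : 'I_n.+1 => (j < k)%N)); last by move=> j; rewrite inE.
rewrite (big_ord_narrow kn); apply: eq_bigr => i _.
by rewrite A'E; exact: (normal (widen_ord kn i)).
Qed.

End model.

(** * Averaging over the global sign and the permutations *)

Section symmetrization.
Context (R : realType) (rho gamma : R).
Local Notation gauss := (normal_prob (0 : R) 1).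
Context (rho_gt0 : 0 < rho) (rho_lt1 : rho < 1) (gamma_gt0 : 0 < gamma).
Context d (T : measurableType d) (P : probability T R).
Context (N : nat) (X : 'I_N.+2 -> T -> R).
Context (mX : forall i, measurable_fun setT (X i)) (lX : iid_law P gauss X).

Let V (x : N.+2.-tuple R) := equicorrelated rho x.
Let tup w := [tuple X i w | i < N.+2].
Let mtup : measurable_fun setT tup := measurable_vector mX.
Let g (t : R) := expR (gamma * t).

Let mV j : measurable_fun setT (V ^~ j).
Proof. exact: measurable_equicorrelated. Qed.

Let mg0 : measurable_fun setT g.
Proof. by apply: measurableT_comp => //; exact: measurable_funM. Qed.

Let mg (f : N.+2.-tuple R -> R) : measurable_fun setT f -> measurable_fun setT (g \o f).
Proof. exact: measurableT_comp. Qed.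

Definition symmetric_weight n q (x : N.+2.-tuple R) : R :=
  (among_top n q (fun j => `|V x j|) ord0)%:R * g `|V x ord0|.

Lemma measurable_symmetric_weight n q : measurable_fun setT (symmetric_weight n q).
Proof.
apply: measurable_funM.
  apply: measurable_natr_bool.
  apply: (@measurable_among_top _ _ _ _ n q
    (fun j (x : N.+2.-tuple R) => `|V x j|) ord0) => j.
  exact: measurableT_comp.
apply: mg; exact: measurableT_comp.
Qed.

(** The exponential factor cancels the normalization of the shift density; the factor 2 pays for
    adding the sign-reversed copy, which has the same integral. *)
Lemma integral_rejects n q : (q < n <= N.+1)%N ->
  ((2 * expR (gamma ^+ 2 / 2))%:E *
   \int[P]_w (rejects n q (equicorrelated rho (shifted rho gamma (tup w))))%:R%:E =
   \int[P]_w (symmetric_weight n q (tup w))%:E)%E.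
Proof.
move=> qn; set c := expR _.
pose F (x : N.+2.-tuple R) : \bar R := (rejects n q (V x))%:R%:E.
have mF : measurable_fun setT F.
  apply/measurable_EFinP/measurable_natr_bool.
  exact: (@measurable_rejects _ _ _ _ n q (fun j x => V x j)).
have F0 x : (0 <= F x)%E by rewrite lee_fin.
have shE w : shifted rho gamma (tup w) =
    [tuple (X i w + effect_shift rho gamma i)%R | i < N.+2].
  by apply: eq_from_tnth => i; rewrite !tnth_mktuple.
under eq_integral do rewrite shE.
rewrite (girsanov2 (Num.sqrt rho * gamma) (Num.sqrt (1 - rho) * gamma)
  (i1 := ord0) (i2 := lift ord0 ord0) (F := F))//.
pose A (x : N.+2.-tuple R) : R := (rejects n q (V x))%:R * g (V x ord0).
pose B (x : N.+2.-tuple R) : R := (rejects n q (fun j => - V x j))%:R * g (- V x ord0).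
have mA : measurable_fun setT A.
  apply: measurable_funM; last exact: mg.
  apply: measurable_natr_bool.
  exact: (@measurable_rejects _ _ _ _ n q (fun j x => V x j)).
have mB : measurable_fun setT B.
  apply: measurable_funM; last by apply: mg; exact: measurable_funN.
  apply: measurable_natr_bool.
  apply: (@measurable_rejects _ _ _ _ n q (fun j x => - V x j)) => j.
  exact: measurable_funN.
have A0 x : 0 <= A x by rewrite mulr_ge0// expR_ge0.
have B0 x : 0 <= B x by rewrite mulr_ge0// expR_ge0.
have AB : (\int[P]_w (A (tup w))%:E = \int[P]_w (B (tup w))%:E)%E.
  have mNX i : measurable_fun setT (fun w => - X i w) by exact: measurable_funN.
  rewrite (@iid_law_unique _ _ _ _ _ P P _ _ _ _ mX mNX lX (iid_law_opp lX)
    (EFin \o A)); first last.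
  - by move=> x; rewrite lee_fin.
  - exact/measurable_EFinP.
  apply: eq_integral => w _ /=; rewrite /A /B.
  have VN j : V [tuple - X i w | i < N.+2] j = - V (tup w) j.
    by rewrite /V /equicorrelated !tnth_mktuple !mulrN opprD.
  by rewrite VN; congr ((rejects _ _ _)%:R * _)%:E; apply/funext.
transitivity ((2 * c)%:E * \int[P]_w ((c^-1)%:E * (A (tup w))%:E))%E.
  congr (_ * _)%E; apply: eq_integral => w _; rewrite /F -!EFinM; congr (_%:E).
  rewrite /A mulrCA; congr (_ * _); rewrite /g /c -expRN -expRD; congr expR.
  (* The squared shifts add up to gamma^2, since rho + (1 - rho) = 1. *)
  rewrite !exprMn !sqr_sqrtr ?subr_ge0 ?ltW//.
  by rewrite /V /equicorrelated !tnth_mktuple; field.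
rewrite ge0_integralZl//; last 3 first.
- exact/measurable_EFinP/(measurableT_comp mA mtup).
- by move=> w _; rewrite lee_fin.
- by rewrite lee_fin invr_ge0 expR_ge0.
rewrite muleA -EFinM mulfK ?gt_eqF ?expR_gt0//.
rewrite mule_natl mule2n.
rewrite [X in (_ + X)%E]AB -ge0_integralD//; last 4 first.
- by move=> w _; rewrite lee_fin.
- exact/measurable_EFinP/(measurableT_comp mA mtup).
- by move=> w _; rewrite lee_fin.
- exact/measurable_EFinP/(measurableT_comp mB mtup).
apply: eq_integral => w _; rewrite -EFinD; congr (_%:E).
exact: rejects_opp.
Qed.

(** [lift_perm ord0 ord0 s] fixes the common factor and permutes the other noise terms, hence
    permutes the estimates by [s]; every [s] contributes the same integral. *)
Lemma integral_top_sum n q :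
  ((#|{: {perm 'I_N.+1}}|)%:R%:E * \int[P]_w (symmetric_weight n q (tup w))%:E =
   \int[P]_w (top_sum g n q (fun j => `|V (tup w) j|))%:E)%E.
Proof.
pose W (s : {perm 'I_N.+1}) w : R :=
  (among_top n q ((fun j => `|V (tup w) j|) \o s) ord0)%:R * g `|V (tup w) (s ord0)|.
pose Xs (s : {perm 'I_N.+1}) i := X (lift_perm ord0 ord0 s i).
have WE s w : W s w = symmetric_weight n q [tuple Xs s i w | i < N.+2].
  have VE j : V [tuple Xs s i w | i < N.+2] j = V (tup w) (s j).
    by rewrite /V /equicorrelated !tnth_mktuple /Xs lift_perm_id lift_perm_lift.
  rewrite /W /symmetric_weight VE; congr ((among_top _ _ _ _)%:R * _).
  by apply/funext => j; rewrite /= VE.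
have mXs s i : measurable_fun setT (Xs s i) by exact: mX.
have mw := measurable_symmetric_weight n q.
transitivity (\int[P]_w \sum_(s : {perm 'I_N.+1}) (W s w)%:E)%E; last first.
  by apply: eq_integral => w _; rewrite sumEFin.
rewrite ge0_integral_sum//; last 2 first.
- move=> s; under eq_fun do rewrite WE.
  exact/measurable_EFinP/(measurableT_comp mw (measurable_vector (mXs s))).
- by move=> s w _; rewrite lee_fin mulr_ge0// expR_ge0.
rewrite (eq_bigr (fun=> \int[P]_w (symmetric_weight n q (tup w))%:E)%E).
  by rewrite sumr_const mule_natl; congr (_ *+ _)%R.
move=> s _; rewrite [RHS](iid_law_unique mX (mXs s) lX
  (iid_law_perm (lift_perm ord0 ord0 s) lX) (F := EFin \o symmetric_weight n q)).
- by apply: eq_integral => w _; rewrite WE.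
- exact/measurable_EFinP.
- by move=> x; rewrite lee_fin mulr_ge0// expR_ge0.
Qed.

(** A tie means V_i = V_j or V_i = - V_j. The own noise term of V_i has coefficient sqrt(1 - rho),
    which is nonzero, and does not enter V_j, so the other coordinates determine it. *)
Lemma ties_null : exists D : set T, [/\ measurable D, P D = 0%E &
  forall w, ~ D w -> injective (fun j => `|V (tup w) j|)].
Proof.
pose E (p : 'I_N.+1 * 'I_N.+1 * R) (x : N.+2.-tuple R) :=
  V x p.1.1 = p.2 * V x p.1.2.
have mE p : measurable (E p).
  have m : measurable_fun setT (fun x => V x p.1.1 == p.2 * V x p.1.2).
    by apply: measurable_fun_eqr => //; exact: measurable_funM.
  rewrite (_ : E p = setT `&` (fun x => V x p.1.1 == p.2 * V x p.1.2) @^-1` [set true]).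
    exact: m.
  by rewrite setTI; apply/seteqP; split => x /eqP.
have E0 p : p.1.1 != p.1.2 -> P [set w | E p (tup w)] = 0%E.
  move=> ij; apply: (iid_law_null (i := lift ord0 p.1.1)) => // w.
  pose c := p.2 * V (tup w) p.1.2 - Num.sqrt rho * X ord0 w.
  exists (c / Num.sqrt (1 - rho)) => t; rewrite /E /V /equicorrelated !tnth_mktuple.
  rewrite eqxx (_ : (ord0 == lift ord0 p.1.1) = false)//.
  rewrite (inj_eq lift_inj) eq_sym (negbTE ij) => e.
  have s0 : Num.sqrt (1 - rho) != 0 by rewrite gt_eqF// sqrtr_gt0 subr_gt0.
  apply: (mulIf s0); rewrite divfK// /c /V /equicorrelated !tnth_mktuple -e.
  by ring.
pose D := \big[setU/set0]_(p : 'I_N.+1 * 'I_N.+1 | p.1 != p.2)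
  ([set w | E (p, 1) (tup w)] `|` [set w | E (p, -1) (tup w)]).
have mEt p : measurable [set w | E p (tup w)].
  by rewrite -[X in measurable X]setTI; exact: mtup.
have [mD D0] : measurable D /\ P D = 0%E.
  apply: (big_ind (fun A => measurable A /\ P A = 0%E)).
  - by split => //; exact: measure0.
  - by move=> A B [mA A0] [mB B0]; split; [exact: measurableU|exact: null_set_setU].
  - move=> p p12; split; first exact: measurableU.
    by apply: null_set_setU => //; exact: E0.
exists D; split => // w Dw i j /= ij; apply/eqP; apply: contra_notT Dw => neq.
rewrite /D (bigD1 (i, j))//=; left.
have := eqr_norm2; move/eqP: ij; rewrite eqr_norm2 => /orP[/eqP h|/eqP h].
  by left; rewrite /E/= mul1r.
by right; rewrite /E/= mulN1r.
Qed.

Lemma measurable_top_sum n q :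
  measurable_fun setT (fun w => top_sum g n q (fun j => `|V (tup w) j|)).
Proof.
have mVt j : measurable_fun setT (fun w => `|V (tup w) j|).
  by apply: measurableT_comp => //; exact: (measurableT_comp (mV j) mtup).
apply: measurable_sum => s; apply: measurable_funM.
  apply: measurable_natr_bool.
  exact: (@measurable_among_top _ _ _ _ n q (fun j w => `|V (tup w) (s j)|) ord0).
exact: (measurableT_comp mg0 (mVt _)).
Qed.

Lemma integral_rejects_lty n q :
  (\int[P]_w
     (rejects n q (equicorrelated rho (shifted rho gamma (tup w))))%:R%:E < +oo)%E.
Proof.
apply: (@le_lt_trans _ _ (\int[P]_w (cst 1 w))%E); last first.
  by rewrite integral_cst// mul1e (le_lt_trans (probability_le1 P measurableT))// ltry.
apply: ge0_le_integral => //.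
- apply/measurable_EFinP/measurable_natr_bool.
  exact: (measurableT_comp (@measurable_rejects_shifted _ rho gamma N n q) mtup).
- by move=> w _; rewrite lee_fin; case: rejects.
Qed.

Lemma integral_rejects_lt m q : (1 < m)%N -> (0 < q)%N -> N.+1 = (q.+1 * m)%N ->
  (\int[P]_w
     (rejects (q * m) q (equicorrelated rho (shifted rho gamma (tup w))))%:R%:E <
   \int[P]_w
     (rejects N.+1 q.+1 (equicorrelated rho (shifted rho gamma (tup w))))%:R%:E)%E.
Proof.
move=> m1 q0 NE; set c := 2 * expR (gamma ^+ 2 / 2); set M := #|{: {perm 'I_N.+1}}|.
have c0 : 0 < c by rewrite mulr_gt0// expR_gt0.
have M0 : (0 < M)%N by apply/card_gt0P; exists 1%g.
rewrite -(@lte_pmul2l _ c%:E)// !integral_rejects; [|by apply/andP; split; nia..].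
rewrite -(@lte_pmul2l _ M%:R%:E) ?lte_fin ?ltr0n// !integral_top_sum.
have [D [mD D0 Dinj]] := ties_null.
have ts0 n q' w : 0 <= top_sum g n q' (fun j => `|V (tup w) j|).
  by apply: sumr_ge0 => s _; rewrite mulr_ge0// expR_ge0.
apply: (integral_lt_ae (N := D)) => //;
  [exact: measurable_top_sum|exact: measurable_top_sum| |].
  (* Read backwards, the two identities give finiteness: the integral is a constant times a
     probability. *)
  rewrite -integral_top_sum -integral_rejects; last by apply/andP; split; nia.
  apply: lte_mul_pinfty => //; apply: lte_mul_pinfty => //.
  exact: integral_rejects_lty.
move=> w /Dinj inj; apply: top_sum_lt => //.
- by move=> x; exact: expR_gt0.
- by move=> x y xy; rewrite ltr_expR ltr_pM2l.
Qed.

End symmetrization.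

Theorem theoremA4 (R : realType) (rho gamma alpha : R)
  (rho_gt0 : 0 < rho) (rho_lt1 : rho < 1) (gamma_gt0 : 0 < gamma)
  (alpha_gt0 : 0 < alpha) (alpha_lt : alpha < 1 / 2)
  (Rq : nat -> nat)
  (RqE : forall q : nat, (0 < q)%N -> (Rq q)%:R = q%:R / (2 * alpha))
  (q : nat) (q_gt0 : (0 < q)%N)
  (d d' : measure_display) (T : measurableType d) (T' : measurableType d')
  (P : probability T R) (P' : probability T' R)
  (Z : nat -> {RV P >-> R}) (Z' : nat -> {RV P' >-> R})
  (Z_iid : iid_standard_normal (Rq q) Z)
  (Z'_iid : iid_standard_normal (Rq q.+1) Z') :
  (power rho gamma alpha (Rq q.+1) Z' > power rho gamma alpha (Rq q) Z)%E.
Proof.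
pose m := Rq 1%N.
have mE : m%:R = 1 / (2 * alpha) :> R by rewrite RqE.
have alphaE : 2 * alpha * m%:R = 1.
  by rewrite mE mulrCA mulfV ?mulr1// gt_eqF// mulr_gt0.
have m1 : (1 < m)%N by rewrite -(ltr_nat R) mE ltr_pdivlMr ?mulr_gt0//; lra.
have RqE' p : (0 < p)%N -> Rq p = (p * m)%N.
  move=> p0; apply/eqP; rewrite -(eqr_nat R) RqE// natrM mE.
  by rewrite mulrA mulr1.
(* Since [2 * alpha * m = 1], the level leaves exactly [p] of the [2 * Rq p] entries for the upper
   tail. *)
have level p : (0 < p)%N ->
    (0 < p < Rq p)%N /\ (1 - alpha) * (Rq p).*2%:R = ((Rq p).*2 - p)%:R.
  move=> p0; rewrite (RqE' p p0); split; first by apply/andP; split; nia.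
  rewrite natrB; last by nia.
  rewrite -mul2n !natrM mulrBl mul1r; congr (_ - _).
  have -> : alpha * (2 * (p%:R * m%:R)) = p%:R * (2 * alpha * m%:R) by ring.
  by rewrite alphaE mulr1.
have [q_lt q_level] := level q q_gt0; have [q'_lt q'_level] := level q.+1 isT.
have Rq_pos p : (0 < p)%N -> (0 < Rq p)%N by move=> p0; rewrite RqE'; nia.
have Rq_le : (Rq q <= Rq q.+1)%N by rewrite !RqE'//; nia.
case En : (Rq q) (Rq_pos q q_gt0) => [//|M] _.
case EN : (Rq q.+1) (Rq_pos q.+1 isT) => [//|N] _.
have MN : (M.+2 <= N.+2)%N by rewrite -En -EN.
rewrite En in Z_iid q_lt q_level; rewrite EN in Z'_iid q'_lt q'_level.
have lZ := iid_standard_normal_law (leqnn _) Z_iid.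
have lZM := iid_standard_normal_law MN Z'_iid.
have lZ' := iid_standard_normal_law (leqnn _) Z'_iid.
(* The smaller experiment is moved to the space of [Z'], whose first [M.+2] variables have the same
   joint law as those of [Z]. *)
have -> : power rho gamma alpha M.+1 Z = power rho gamma alpha M.+1 Z'.
  rewrite !(power_integral gamma rho_gt0 rho_lt1 (N := M) _ _ q_lt q_level)//.
  have mF : measurable_fun setT (fun x : M.+2.-tuple R =>
      (rejects M.+1 q (equicorrelated rho (shifted rho gamma x)))%:R%:E : \bar R).
    apply/measurable_EFinP; apply: measurable_natr_bool.
    exact: measurable_rejects_shifted.
  exact: (iid_law_unique _ _ lZ lZM mF).
rewrite (power_integral gamma rho_gt0 rho_lt1 _ (MN : (M.+1 <= N.+1)%N) q_lt q_level).
rewrite (power_integral gamma rho_gt0 rho_lt1 (N := N) _ _ q'_lt q'_level)//.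
rewrite (_ : M.+1 = (q * m)%N); last by rewrite -En RqE'.
apply: integral_rejects_lt => //.
by rewrite -EN RqE'.
Qed.
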